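(* Let $R$ be a $\phi$-ring. Then the following assertions are equivalent: (1) $R$ is a $\phi$-Prüfer ring. (2) $(I \cap J)\cdot K = IK \cap JK$ for any three nonnil ideals $I, J, K$ of $R$.
   Context: All rings are commutative with nonzero identity. For a ring $R$, $\mathrm{Nil}(R)$ denotes the ideal of nilpotent elements, $Z(R)$ the set of zerodivisors and $T(R)$ the total quotient ring. A prime ideal $P$ of $R$ is called divided if it is comparable (under inclusion) to every ideal of $R$. $R$ is a $\phi$-ring if $\mathrm{Nil}(R)$ is a divided prime ideal of $R$. An ideal $I$ of $R$ is nonnil if $I \not\subseteq \mathrm{Nil}(R)$. For a $\phi$-ring $R$, let $\phi: T(R) \to R_{\mathrm{Nil}(R)}$ be the ring homomorphism $\phi(a/b) = a/b$ for $a\in R$, $b \in R\setminus Z(R)$; restricted to $R$ it is the ring homomorphism $x \mapsto x/1$, with image the ring $\phi(R)$. A nonnil ideal $I$ of a $\phi$-ring $R$ is $\phi$-invertible if $\phi(I)$ is an invertible ideal of $\phi(R)$, i.e. $\phi(I)\,\phi(I)^{-1} = \phi(R)$ where $\phi(I)^{-1} = \{x \in T(\phi(R)) : x\phi(I) \subseteq \phi(R)\}$. A $\phi$-ring $R$ is $\phi$-Prüfer if every finitely generated nonnil ideal of $R$ is $\phi$-invertible. *)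

(* Defs.v *)
From HB Require Import structures.
From mathcomp Require Import all_boot all_order all_algebra generic_quotient ring.
From mathcomp Require Import boolp classical_sets.

Set Implicit Arguments.
Unset Strict Implicit.
Unset Printing Implicit Defensive.

Import GRing.Theory.
Local Open Scope classical_set_scope.
Local Open Scope ring_scope.
Local Open Scope quotient_scope.

(* Ideals are sets, not necessarily proper: the predicates idealr_closed and
   prime_idealr_closed of ring_quotient exclude the unit ideal. *)
Section Ideals.
Variable R : comPzRingType.
Implicit Types (I J P : set R).

Definition is_ideal I :=
  [/\ I 0, forall x y, I x -> I y -> I (x + y) & forall a x, I x -> I (a * x)].

Definition is_prime_ideal P :=
  [/\ is_ideal P, ~ P 1 & forall x y, P (x * y) -> P x \/ P y].

Definition is_divided_prime P :=
  is_prime_ideal P /\ forall J, is_ideal J -> P `<=` J \/ J `<=` P.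

Definition finitely_generated I :=
  exists (n : nat) (g : 'I_n -> R),
    I = [set x | exists c : 'I_n -> R, x = \sum_(i < n) c i * g i].

(* Finite sums of products; used for ideals and for fractional ideals. *)
Definition prod_set I J : set R :=
  [set x | exists (n : nat) (a b : 'I_n -> R),
    [/\ forall i, I (a i), forall i, J (b i) & x = \sum_(i < n) a i * b i]].

Definition Nil : set R := [set x | exists n : nat, x ^+ n = 0].

Definition zerodiv : set R := [set x | exists2 y : R, y != 0 & x * y = 0].

Definition nonnil_ideal I := is_ideal I /\ ~ (I `<=` Nil).

End Ideals.

Arguments Nil R : clear implicits.
Arguments zerodiv R : clear implicits.

Definition phi_ring (R : comNzRingType) := is_divided_prime (Nil R).

(* Localization of R at a multiplicative subset S, as the quotient of R x S
   by (a, s) ~ (b, t) iff u (a t) = u (b s) for some u in S. If 0 is in S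
   this is the zero ring, hence only a comPzRingType. *)
Section Localization.
Variables (R : comPzRingType) (S : mulrClosed R).

Definition den := {s : R | s \in S}.
Implicit Types x y z : (R * den)%type.

Definition den1 : den := exist _ 1 (rpred1 S).
Definition denM (s t : den) : den :=
  exist _ (sval s * sval t) (rpredM (valP s) (valP t)).

Definition loc_rel x y : bool :=
  `[< exists u : den, sval u * (x.1 * sval y.2) = sval u * (y.1 * sval x.2) >].

Lemma loc_relP x y :
  reflect (exists u : den, sval u * (x.1 * sval y.2) = sval u * (y.1 * sval x.2))
          (loc_rel x y).
Proof. exact: asboolP. Qed.

Lemma loc_rel_refl : reflexive loc_rel.
Proof. by move=> x; apply/loc_relP; exists den1. Qed.

Lemma loc_rel_sym : symmetric loc_rel.
Proof. by move=> x y; apply/loc_relP/loc_relP => -[u e]; exists u. Qed.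

Lemma loc_rel_trans : transitive loc_rel.
Proof.
move=> [a s] [b t] [c r] /loc_relP[u /= e] /loc_relP[v /= f].
apply/loc_relP; exists (denM (denM u v) s) => /=.
rewrite [LHS](_ : _ = sval v * sval r * (sval u * (b * sval s))); last by ring.
rewrite e [LHS](_ : _ = sval u * sval t * (sval v * (a * sval r))); last by ring.
by rewrite f; ring.
Qed.

Canonical loc_equiv := EquivRel loc_rel loc_rel_refl loc_rel_sym loc_rel_trans.

Definition localization := {eq_quot loc_rel}.
HB.instance Definition _ : EqQuotient _ loc_rel localization :=
  EqQuotient.on localization.
HB.instance Definition _ := Choice.on localization.

Definition loc_frac (a : R) (s : den) : localization :=
  \pi_localization (a, s).

Lemma loc_fracP a s b t :
  loc_frac a s = loc_frac b t <->
  exists u : den, sval u * (a * sval t) = sval u * (b * sval s).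
Proof.
split; first by move=> /eqmodP/loc_relP.
by move=> h; apply/eqmodP/loc_relP.
Qed.

Lemma loc_fracE (q : localization) : q = loc_frac (repr q).1 (repr q).2.
Proof. by rewrite /loc_frac -surjective_pairing reprK. Qed.

Lemma loc_frac_ind (Q : localization -> Prop) :
  (forall a s, Q (loc_frac a s)) -> forall q, Q q.
Proof. by move=> h q; rewrite [q]loc_fracE. Qed.

Definition loc_add (p q : localization) : localization :=
  loc_frac ((repr p).1 * sval (repr q).2 + (repr q).1 * sval (repr p).2)
           (denM (repr p).2 (repr q).2).
Definition loc_opp (p : localization) : localization :=
  loc_frac (- (repr p).1) (repr p).2.
Definition loc_mul (p q : localization) : localization :=
  loc_frac ((repr p).1 * (repr q).1) (denM (repr p).2 (repr q).2).

Lemma repr_frac a s : exists u : den,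
  sval u * ((repr (loc_frac a s)).1 * sval s)
  = sval u * (a * sval (repr (loc_frac a s)).2).
Proof. by apply/loc_fracP; rewrite -loc_fracE. Qed.

Lemma loc_addE a s b t :
  loc_add (loc_frac a s) (loc_frac b t)
  = loc_frac (a * sval t + b * sval s) (denM s t).
Proof.
rewrite /loc_add; have [u] := repr_frac a s; have [v] := repr_frac b t.
move: (repr (loc_frac a s)) (repr (loc_frac b t)) => [a' s'] [b' t'] /= f e.
apply/loc_fracP; exists (denM u v) => /=.
rewrite [LHS](_ : _ = sval v * sval t * sval t' * (sval u * (a' * sval s))
                 + sval u * sval s * sval s' * (sval v * (b' * sval t))); last by ring.
by rewrite e f; ring.
Qed.

Lemma loc_oppE a s : loc_opp (loc_frac a s) = loc_frac (- a) s.
Proof.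
rewrite /loc_opp; have [u] := repr_frac a s.
move: (repr _) => [a' s'] /= e; apply/loc_fracP; exists u => /=.
by rewrite !mulNr !mulrN e.
Qed.

Lemma loc_mulE a s b t :
  loc_mul (loc_frac a s) (loc_frac b t) = loc_frac (a * b) (denM s t).
Proof.
rewrite /loc_mul; have [u] := repr_frac a s; have [v] := repr_frac b t.
move: (repr (loc_frac a s)) (repr (loc_frac b t)) => [a' s'] [b' t'] /= f e.
apply/loc_fracP; exists (denM u v) => /=.
rewrite [LHS](_ : _ = (sval u * (a' * sval s)) * (sval v * (b' * sval t))); last by ring.
by rewrite e f; ring.
Qed.

Lemma loc_addA : associative loc_add.
Proof.
elim/loc_frac_ind=> a s; elim/loc_frac_ind=> b t; elim/loc_frac_ind=> c r.
by rewrite !loc_addE; apply/loc_fracP; exists den1 => /=; ring.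
Qed.

Lemma loc_addC : commutative loc_add.
Proof.
elim/loc_frac_ind=> a s; elim/loc_frac_ind=> b t.
by rewrite !loc_addE; apply/loc_fracP; exists den1 => /=; ring.
Qed.

Lemma loc_add0 : left_id (loc_frac 0 den1) loc_add.
Proof.
elim/loc_frac_ind=> a s.
by rewrite !loc_addE; apply/loc_fracP; exists den1 => /=; ring.
Qed.

Lemma loc_addN : left_inverse (loc_frac 0 den1) loc_opp loc_add.
Proof.
elim/loc_frac_ind=> a s.
by rewrite loc_oppE loc_addE; apply/loc_fracP; exists den1 => /=; ring.
Qed.

HB.instance Definition _ :=
  GRing.isZmodule.Build localization loc_addA loc_addC loc_add0 loc_addN.

Lemma loc_mulA : associative loc_mul.
Proof.
elim/loc_frac_ind=> a s; elim/loc_frac_ind=> b t; elim/loc_frac_ind=> c r.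
by rewrite !loc_mulE; apply/loc_fracP; exists den1 => /=; ring.
Qed.

Lemma loc_mulC : commutative loc_mul.
Proof.
elim/loc_frac_ind=> a s; elim/loc_frac_ind=> b t.
by rewrite !loc_mulE; apply/loc_fracP; exists den1 => /=; ring.
Qed.

Lemma loc_mul1 : left_id (loc_frac 1 den1) loc_mul.
Proof.
elim/loc_frac_ind=> a s.
by rewrite !loc_mulE; apply/loc_fracP; exists den1 => /=; ring.
Qed.

Lemma loc_mulDl : left_distributive loc_mul loc_add.
Proof.
elim/loc_frac_ind=> a s; elim/loc_frac_ind=> b t; elim/loc_frac_ind=> c r.
by rewrite !(loc_addE, loc_mulE); apply/loc_fracP; exists den1 => /=; ring.
Qed.

HB.instance Definition _ :=
  GRing.Zmodule_isComPzRing.Build localization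
    loc_mulA loc_mulC loc_mul1 loc_mulDl.

Definition to_loc (a : R) : localization := loc_frac a den1.

Lemma to_loc_is_zmod_morphism : zmod_morphism to_loc.
Proof.
move=> a b; rewrite /to_loc -[RHS]/(loc_add _ (loc_opp _)) loc_oppE loc_addE.
by apply/loc_fracP; exists den1 => /=; ring.
Qed.

HB.instance Definition _ :=
  GRing.isZmodMorphism.Build R localization to_loc to_loc_is_zmod_morphism.

Lemma to_loc_is_monoid_morphism : monoid_morphism to_loc.
Proof.
split=> [//|a b]; rewrite /to_loc -[RHS]/(loc_mul _ _) loc_mulE.
by apply/loc_fracP; exists den1 => /=; ring.
Qed.

HB.instance Definition _ :=
  GRing.isMonoidMorphism.Build R localization to_loc to_loc_is_monoid_morphism.

End Localization.

(* The map S^-1 R -> S'^-1 R, a / s |-> a / s, for S included in S'. It is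
   written with representatives; loc_mapE shows that it does not depend on
   their choice. *)
Section LocalizationMap.
Variables (R : comPzRingType) (S S' : mulrClosed R).
Hypothesis subS : {subset S <= S'}.

Definition den_map (s : den S) : den S' := exist _ (sval s) (subS (valP s)).

Definition loc_map (q : localization S) : localization S' :=
  loc_frac (repr q).1 (den_map (repr q).2).

Lemma loc_mapE a s : loc_map (loc_frac a s) = loc_frac a (den_map s).
Proof.
by have [u e] := repr_frac a s; apply/loc_fracP; exists (den_map u).
Qed.

Lemma loc_map_is_zmod_morphism : zmod_morphism loc_map.
Proof.
elim/loc_frac_ind=> a s; elim/loc_frac_ind=> b t.
rewrite -[X in loc_map X]/(loc_add _ (loc_opp _)) loc_oppE loc_addE !loc_mapE.
rewrite -[RHS]/(loc_add _ (loc_opp _)) loc_oppE loc_addE.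
by apply/loc_fracP; exists (den1 S') => /=; ring.
Qed.

HB.instance Definition _ :=
  GRing.isZmodMorphism.Build (localization S) (localization S') loc_map
    loc_map_is_zmod_morphism.

Lemma loc_map_is_monoid_morphism : monoid_morphism loc_map.
Proof.
split; first by rewrite -[1]/(loc_frac 1 (den1 S)) loc_mapE;
  apply/loc_fracP; exists (den1 S').
elim/loc_frac_ind=> a s; elim/loc_frac_ind=> b t.
rewrite -[X in loc_map X]/(loc_mul _ _) loc_mulE !loc_mapE.
rewrite -[RHS]/(loc_mul _ _) loc_mulE.
by apply/loc_fracP; exists (den1 S') => /=; ring.
Qed.

HB.instance Definition _ :=
  GRing.isMonoidMorphism.Build (localization S) (localization S') loc_map
    loc_map_is_monoid_morphism.

End LocalizationMap.

Section TotalQuotientRing.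
Variable R : comPzRingType.

Definition regular : {pred R} := [pred x | `[< ~ zerodiv R x >]].

Lemma regularP x : reflect (~ zerodiv R x) (x \in regular).
Proof. exact: asboolP. Qed.

Lemma regular_mulr_closed : mulr_closed regular.
Proof.
split.
  by apply/regularP => -[y /negP y0]; rewrite mul1r => /eqP.
move=> x y /regularP rx /regularP ry; apply/regularP => -[z z0 e].
have [yz0|yz0] := eqVneq (y * z) 0; first by apply: ry; exists z.
by apply: rx; exists (y * z) => //; rewrite mulrA.
Qed.

HB.instance Definition _ :=
  GRing.isMulClosed.Build R regular regular_mulr_closed.

Definition total_quotient_ring := localization regular.
HB.instance Definition _ := GRing.ComPzRing.on total_quotient_ring.

Definition to_total : R -> total_quotient_ring := @to_loc R regular.
HB.instance Definition _ := GRing.RMorphism.on to_total.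

Definition ideal_inv (I : set R) : set total_quotient_ring :=
  [set x | forall a, I a -> range to_total (x * to_total a)].

Definition invertible (I : set R) :=
  prod_set (to_total @` I) (ideal_inv I) = range to_total.

End TotalQuotientRing.

Arguments regular R : clear implicits.
Arguments total_quotient_ring R : clear implicits.
Arguments to_total R : clear implicits.

(* The image of a ring morphism f, as a ring, and f with codomain restricted
   to its image. *)
Section ImageRing.
Variables (A B : comPzRingType) (f : {rmorphism A -> B}).

Definition image_pred : {pred B} := [pred y | `[< range f y >]].

Lemma imageP y : reflect (range f y) (y \in image_pred).
Proof. exact: asboolP. Qed.

Lemma image_subring_closed : subring_closed image_pred.
Proof.
split.
- by apply/imageP; exists 1; rewrite ?rmorph1.
- move=> _ _ /imageP[a _ <-] /imageP[b _ <-].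
  by apply/imageP; exists (a - b); rewrite ?rmorphB.
- move=> _ _ /imageP[a _ <-] /imageP[b _ <-].
  by apply/imageP; exists (a * b); rewrite ?rmorphM.
Qed.

HB.instance Definition _ :=
  GRing.isSubringClosed.Build B image_pred image_subring_closed.

Record image_ring :=
  ImageRing { image_val : B; image_valP : image_val \in image_pred }.
HB.instance Definition _ := [isSub for image_val].
HB.instance Definition _ := [Choice of image_ring by <:].
HB.instance Definition _ :=
  GRing.SubChoice_isSubComPzRing.Build B image_pred image_ring
    image_subring_closed.

Lemma image_mem a : f a \in image_pred.
Proof. by apply/imageP; exists a. Qed.

Definition to_image (a : A) : image_ring := ImageRing (image_mem a).

Lemma to_image_is_zmod_morphism : zmod_morphism to_image.
Proof. by move=> a b; apply: val_inj; rewrite /= rmorphB. Qed.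

HB.instance Definition _ :=
  GRing.isZmodMorphism.Build A image_ring to_image to_image_is_zmod_morphism.

Lemma to_image_is_monoid_morphism : monoid_morphism to_image.
Proof.
by split=> [|a b]; apply: val_inj; rewrite /= ?rmorph1 ?rmorphM.
Qed.

HB.instance Definition _ :=
  GRing.isMonoidMorphism.Build A image_ring to_image
    to_image_is_monoid_morphism.

End ImageRing.

(* The localization of R at Nil(R) only makes sense once Nil(R) is prime, so
   these definitions take the proof that R is a phi-ring as an argument. *)
Section PhiRing.
Variable R : comNzRingType.

Definition nonnil (hR : phi_ring R) : {pred R} := [pred x | `[< ~ Nil R x >]].

Variable hR : phi_ring R.

Lemma nonnilP x : reflect (~ Nil R x) (x \in nonnil hR).
Proof. exact: asboolP. Qed.

Lemma nonnil_mulr_closed : mulr_closed (nonnil hR).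
Proof.
have [[_ N1 NM] _] := hR; split; first exact/nonnilP.
by move=> x y /nonnilP Nx /nonnilP Ny; apply/nonnilP => /NM[].
Qed.

HB.instance Definition _ :=
  GRing.isMulClosed.Build R (nonnil hR) nonnil_mulr_closed.

Lemma regular_nonnil : {subset regular R <= nonnil hR}.
Proof.
move=> x /regularP rx; apply/nonnilP => -[n xn].
elim: n xn => [/eqP|n IHn]; first by rewrite expr0 oner_eq0.
rewrite exprS; have [/IHn//|xn0 e] := eqVneq (x ^+ n) 0.
by apply: rx; exists (x ^+ n).
Qed.

Definition loc_Nil := localization (nonnil hR).
HB.instance Definition _ := GRing.ComPzRing.on loc_Nil.

Definition phi : total_quotient_ring R -> loc_Nil := loc_map regular_nonnil.
HB.instance Definition _ := GRing.RMorphism.on phi.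

Definition phi_restr : R -> loc_Nil := phi \o to_total R.
HB.instance Definition _ := GRing.RMorphism.on phi_restr.

Lemma phi_restrE x : phi_restr x = to_loc (nonnil hR) x.
Proof.
by rewrite /phi_restr /= /phi loc_mapE; apply/loc_fracP; exists (den1 _).
Qed.

Definition phiR := image_ring phi_restr.
HB.instance Definition _ := GRing.ComPzRing.on phiR.

Definition phi_ideal (I : set R) : set phiR := to_image phi_restr @` I.

Definition phi_invertible (I : set R) := invertible (phi_ideal I).

Definition phi_prufer :=
  forall I : set R, nonnil_ideal I -> finitely_generated I -> phi_invertible I.

End PhiRing.

(* Main.v *)
Require Import Defs.
From mathcomp Require Import all_boot all_algebra classical_sets.
From mathcomp Require Import boolp ring.

Local Open Scope classical_set_scope.

(** The nilradical of a phi-ring R is contained in every nonnil ideal, and in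
every principal ideal sR with s not nilpotent.  So computations with nonnil
ideals may be made up to nilpotent elements, as in the domain R / Nil(R);
in particular s may be cancelled there.  This also removes the fractions:
the kernel of R -> phi(R) consists of nilpotents and the regular elements of
phi(R) are the images of the non-nilpotent ones, so clearing denominators
shows that a nonnil ideal I is phi-invertible iff some non-nilpotent s lies in
I (sR : I) ([phi_invertibleP]).  Call such an ideal denominator-invertible.

If R is phi-Prüfer and x lies in IK and JK, then x lies in I K0 and J K0 for
some finitely generated nonnil K0 contained in K.  Take s in K0 (sR : K0) as
above.  For b in (sR : K0), the element x b lies in s I and in s J, hence, up
to nilpotents, in s (I `&` J); multiplying by K0 and summing, s x lies in
s (I `&` J) K, and s can be cancelled ([cap_mul_of_prufer]).

Conversely, distributivity with K = I + J shows that IJ, which is contained in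
both I (I + J) and J (I + J), is contained in (I `&` J) (I + J).  Multiplying
by inverses of I and J, one sees that I + J is denominator-invertible as soon
as I and J are ([den_invertible_add]).  Principal nonnil ideals are
denominator-invertible, and nil generators can be discarded since the
nilradical lies in every nonnil ideal; induction on the number of generators
concludes ([den_invertible_span]). *)

Set Implicit Arguments.
Unset Strict Implicit.
Unset Printing Implicit Defensive.

Import GRing.Theory.

(** * Ideals, sums, products and residuals *)

Section IdealArithmetic.
Local Open Scope ring_scope.
Variable R : comPzRingType.
Implicit Types (I J K : set R) (s x y : R).

Definition principal s : set R := [set x | exists c, x = s * c].

Definition residual s I : set R :=
  [set b | forall a, I a -> principal s (b * a)].

Definition add_set I J : set R :=
  [set x | exists a b, [/\ I a, J b & x = a + b]].

Definition span n (g : 'I_n -> R) : set R :=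
  [set x | exists c : 'I_n -> R, x = \sum_(i < n) c i * g i].

Lemma ideal_mulr I a x : is_ideal I -> I x -> I (x * a).
Proof. by case=> _ _ IM Ix; rewrite mulrC; apply: IM. Qed.

Lemma ideal_sum I n (F : 'I_n -> R) :
  is_ideal I -> (forall i, I (F i)) -> I (\sum_(i < n) F i).
Proof. by case=> I0 ID _ IF; apply: big_ind. Qed.

Lemma principal_ideal s : is_ideal (principal s).
Proof.
split; first by exists 0; rewrite mulr0.
  by move=> _ _ [a ->] [b ->]; exists (a + b); rewrite mulrDr.
by move=> a _ [b ->]; exists (a * b); ring.
Qed.

Lemma principal_id s : principal s s.
Proof. by exists 1; rewrite mulr1. Qed.

Lemma residual_ideal s I : is_ideal (residual s I).
Proof.
have [P0 PD PM] := principal_ideal s.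
split=> [a _|x y Rx Ry a Ia|c x Rx a Ia]; first by rewrite mul0r.
  by rewrite mulrDl; apply: PD; [apply: Rx | apply: Ry].
by rewrite -mulrA; apply/PM/Rx.
Qed.

Lemma residual_mul s t x I : residual s I x -> residual (t * s) I (t * x).
Proof. by move=> Rx a /Rx[c e]; exists c; rewrite -mulrA e mulrA. Qed.

Lemma cap_ideal I J : is_ideal I -> is_ideal J -> is_ideal (I `&` J).
Proof.
move=> [I0 ID IM] [J0 JD JM]; split=> // [x y [Ix Jx] [Iy Jy]|a x [Ix Jx]].
  by split; [apply: ID | apply: JD].
by split; [apply: IM | apply: JM].
Qed.

Lemma add_ideal I J : is_ideal I -> is_ideal J -> is_ideal (add_set I J).
Proof.
move=> [I0 ID IM] [J0 JD JM]; split; first by exists 0, 0; rewrite addr0.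
  move=> _ _ [a [b [Ia Jb ->]]] [a' [b' [Ia' Jb' ->]]].
  by exists (a + a'), (b + b'); split; [apply: ID | apply: JD | ring].
move=> c _ [a [b [Ia Jb ->]]].
by exists (c * a), (c * b); split; [apply: IM | apply: JM | ring].
Qed.

Lemma add_set_subl I J : is_ideal J -> I `<=` add_set I J.
Proof. by case=> J0 _ _ x Ix; exists x, 0; rewrite addr0. Qed.

Lemma add_set_subr I J : is_ideal I -> J `<=` add_set I J.
Proof. by case=> I0 _ _ x Jx; exists 0, x; rewrite add0r. Qed.

Lemma add_set_min I J K :
  is_ideal K -> I `<=` K -> J `<=` K -> add_set I J `<=` K.
Proof.
by move=> [_ KD _] IK JK _ [a [b [Ia Jb ->]]]; apply: KD; [apply: IK | apply: JK].
Qed.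

Lemma prod_set0 I J : prod_set I J 0.
Proof.
by exists 0%N, (fun _ => 0), (fun _ => 0); split; rewrite ?big_ord0 //; case.
Qed.

Lemma prod_setM I J a b : I a -> J b -> prod_set I J (a * b).
Proof.
by move=> Ia Jb; exists 1%N, (fun _ => a), (fun _ => b); rewrite big_ord1.
Qed.

Lemma prod_setD I J x y :
  prod_set I J x -> prod_set I J y -> prod_set I J (x + y).
Proof.
move=> [n [a [b [Ia Jb ->]]]] [m [a' [b' [Ia' Jb' ->]]]].
exists (n + m)%N,
  (fun i => match split i with inl j => a j | inr j => a' j end),
  (fun i => match split i with inl j => b j | inr j => b' j end).
split=> [i|i|]; try by case: (split i).
rewrite big_split_ord /=; congr (_ + _); apply: eq_bigr => i _.
  by rewrite (unsplitK (inl i : 'I_n + 'I_m)).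
by rewrite (unsplitK (inr i : 'I_n + 'I_m)).
Qed.

Lemma prod_set_ind I J (P : R -> Prop) :
    P 0 -> (forall x y, P x -> P y -> P (x + y)) ->
    (forall a b, I a -> J b -> P (a * b)) ->
  forall x, prod_set I J x -> P x.
Proof.
by move=> P0 PD PM _ [n [a [b [Ia Jb ->]]]]; apply: big_ind => // *; apply: PM.
Qed.

Lemma prod_ideal I J : is_ideal J -> is_ideal (prod_set I J).
Proof.
case=> _ _ JM; split; [exact: prod_set0 | exact: prod_setD | move=> c].
apply: prod_set_ind => [|x y ? ?|a b Ia Jb]; first by rewrite mulr0; apply: prod_set0.
  by rewrite mulrDr; apply: prod_setD.
by rewrite mulrCA; apply: prod_setM => //; apply: JM.
Qed.

Lemma prod_setS I I' J J' :
  I `<=` I' -> J `<=` J' -> prod_set I J `<=` prod_set I' J'.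
Proof.
move=> sI sJ; apply: prod_set_ind; [exact: prod_set0 | exact: prod_setD |].
by move=> a b /sI Ia /sJ Jb; apply: prod_setM.
Qed.

Lemma prod_set_mulr I J J' c x : (forall b, J b -> J' (c * b)) ->
  prod_set I J x -> prod_set I J' (c * x).
Proof.
move=> cJ; move: x; apply: prod_set_ind => [|x y Px Py|a b Ia /cJ Jb].
- by rewrite mulr0; apply: prod_set0.
- by rewrite mulrDr; apply: prod_setD.
by rewrite mulrCA; apply: prod_setM.
Qed.

(** A bound on the product of two ideals with a parameter [c]: used to bound
products of more than two ideals one factor at a time. *)
Lemma prod_set_mul_min I J K c x : is_ideal K ->
  (forall a b, I a -> J b -> K (a * b * c)) -> prod_set I J x -> K (x * c).
Proof.
move=> [K0 KD _] KM; move: x; apply: prod_set_ind => //; first by rewrite mul0r.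
by move=> x y Kx Ky; rewrite mulrDl; apply: KD.
Qed.

Lemma span_ideal n (g : 'I_n -> R) : is_ideal (span g).
Proof.
split; first by exists (fun _ => 0); rewrite big1 // => i _; rewrite mul0r.
  move=> _ _ [c ->] [d ->]; exists (fun i => c i + d i).
  by rewrite -big_split; apply: eq_bigr => i _; rewrite mulrDl.
move=> a _ [c ->]; exists (fun i => a * c i).
by rewrite mulr_sumr; apply: eq_bigr => i _; rewrite mulrA.
Qed.

Lemma span_gen n (g : 'I_n -> R) i : span g (g i).
Proof.
exists (fun j => (j == i)%:R); rewrite (bigD1 i) //= eqxx mul1r big1 ?addr0 //.
by move=> j /negPf ->; rewrite mul0r.
Qed.

Lemma span_min n (g : 'I_n -> R) I :
  is_ideal I -> (forall i, I (g i)) -> span g `<=` I.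
Proof.
by move=> idI Ig _ [c ->]; apply: ideal_sum => // i; case: idI => _ _; apply.
Qed.

Lemma span_recl n (g : 'I_n.+1 -> R) :
  span g = add_set (principal (g ord0)) (span (fun i => g (lift ord0 i))).
Proof.
have idP := principal_ideal (g ord0); have idS := span_ideal (fun i => g (lift ord0 i)).
apply/seteqP; split.
  apply: span_min => [|i]; first exact: add_ideal.
  have [j ->|->] := unliftP ord0 i; first exact/(add_set_subr idP)/span_gen.
  exact/(add_set_subl idS)/principal_id.
apply: add_set_min; first exact: span_ideal.
  by move=> _ [c ->]; apply: ideal_mulr (span_gen _ _); apply: span_ideal.
by apply: span_min => [|i]; [apply: span_ideal | apply: span_gen].
Qed.

Lemma finitely_generated_principal s : finitely_generated (principal s).
Proof.
exists 1%N, (fun _ => s); apply/seteqP; split=> _ [c ->].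
  by exists (fun _ => c); rewrite big_ord1 mulrC.
by exists (c ord0); rewrite big_ord1 mulrC.
Qed.

Lemma finitely_generated_add I J :
  finitely_generated I -> finitely_generated J -> finitely_generated (add_set I J).
Proof.
move=> [n [g eI]] [m [h eJ]].
have {eI}-> : I = span g by [].
have {eJ}-> : J = span h by [].
pose f (i : 'I_(n + m)) := match split i with inl j => g j | inr j => h j end.
have fl i : f (lshift m i) = g i.
  by rewrite /f (unsplitK (inl i : 'I_n + 'I_m)).
have fr i : f (rshift n i) = h i.
  by rewrite /f (unsplitK (inr i : 'I_n + 'I_m)).
exists (n + m)%N, f; apply/seteqP; split.
  apply: add_set_min; first exact: (span_ideal f).
    by apply: span_min => [|i]; [apply: (span_ideal f) | rewrite -fl; apply: span_gen].
  by apply: span_min => [|i]; [apply: (span_ideal f) | rewrite -fr; apply: span_gen].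
apply: span_min => [|i]; first by apply: add_ideal; apply: span_ideal.
rewrite /f; case: (split i) => j.
  exact/(add_set_subl (span_ideal h))/span_gen.
exact/(add_set_subr (span_ideal g))/span_gen.
Qed.

Lemma prod_set_finite I K x : is_ideal K -> prod_set I K x ->
  exists K0, [/\ is_ideal K0, finitely_generated K0, K0 `<=` K & prod_set I K0 x].
Proof.
move=> idK [n [a [b [Ia Kb ->]]]]; exists (span b).
split; [exact: span_ideal | by exists n, b | exact: span_min |].
by exists n, a, b; split=> // i; apply: span_gen.
Qed.

Lemma to_loc_mul_frac (S : mulrClosed R) a (s : den S) :
  to_loc S (sval s) * loc_frac a s = to_loc S a.
Proof.
rewrite -[LHS]/(loc_mul _ _) loc_mulE; apply/loc_fracP.
by exists (den1 S) => /=; ring.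
Qed.

Lemma to_total_inj : injective (to_total R).
Proof.
move=> a b /loc_fracP[[u ru] /=]; rewrite !mulr1 => e.
apply/eqP; rewrite -subr_eq0; apply/negPn/negP => ab.
by case/regularP: ru; exists (a - b) => //; rewrite mulrBr e subrr.
Qed.

End IdealArithmetic.

(** * Invertibility in a phi-ring without fractions *)

Section PhiRings.
Local Open Scope ring_scope.
Variables (R : comNzRingType) (hR : phi_ring R).
Implicit Types (I J K : set R) (s x y : R).

(* The sequence constructor of the same name shadows the nilradical. *)
Local Notation Nil := Defs.Nil.

Let idN : is_ideal (Nil R). Proof. by case: hR => -[]. Qed.

Lemma nonnilM x y : ~ Nil R x -> ~ Nil R y -> ~ Nil R (x * y).
Proof. by case: hR => -[_ _ NM] _ Nx Ny /NM[]. Qed.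

Lemma Nil_cancel s x : ~ Nil R s -> s * x = 0 -> Nil R x.
Proof.
move=> Ns e; case: hR => -[[N0 _ _] _ NM] _.
by case: (NM s x) => //; rewrite e.
Qed.

Lemma Nil_sub I : nonnil_ideal I -> Nil R `<=` I.
Proof. by case=> idI nI; case: hR => _ /(_ I idI)[]. Qed.

Lemma nonnil_idealI I x : is_ideal I -> I x -> ~ Nil R x -> nonnil_ideal I.
Proof. by move=> idI Ix Nx; split=> // /(_ x Ix). Qed.

Lemma nonnil_witness I : nonnil_ideal I -> exists2 x, I x & ~ Nil R x.
Proof.
case=> _ nI; apply: contrapT => h; apply: nI => x Ix.
by apply: contrapT => Nx; apply: h; exists x.
Qed.

Lemma nonnil_principal s : ~ Nil R s -> nonnil_ideal (principal s).
Proof. by apply: nonnil_idealI (principal_ideal s) (principal_id s). Qed.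

Lemma eq_mod_Nil I x y : nonnil_ideal I -> I y -> Nil R (x - y) -> I x.
Proof.
move=> nI Iy /(Nil_sub nI) Ixy; case: nI => -[_ ID _] _.
by rewrite -(subrK y x); apply: ID.
Qed.

Lemma nonnil_prod I J : nonnil_ideal I -> nonnil_ideal J -> nonnil_ideal (prod_set I J).
Proof.
move=> nI nJ; have [idI _] := nI; have [idJ _] := nJ.
have [x Ix Nx] := nonnil_witness nI.
have [y Jy Ny] := nonnil_witness nJ.
apply: (@nonnil_idealI _ (x * y)); first exact: prod_ideal.
  exact: prod_setM.
exact: nonnilM.
Qed.

Lemma nonnil_cap I J : nonnil_ideal I -> nonnil_ideal J -> nonnil_ideal (I `&` J).
Proof.
move=> nI nJ; have [idI _] := nI; have [idJ _] := nJ.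
have [x Ix Nx] := nonnil_witness nI.
have [y Jy Ny] := nonnil_witness nJ.
apply: (@nonnil_idealI _ (x * y)); [exact: cap_ideal | | exact: nonnilM].
by split; [apply: ideal_mulr | case: idJ => _ _; apply].
Qed.

Lemma nonnil_ideal_sup I J : is_ideal J -> nonnil_ideal I -> I `<=` J -> nonnil_ideal J.
Proof. by move=> idJ [_ nI] sIJ; split=> // sJ; apply: nI => x /sIJ/sJ. Qed.

(** In a domain, [s] lies in [I] [(sR : I)] for some [s != 0] exactly when [I] is
invertible, the inverse being [(sR : I)] divided by [s]. *)
Definition den_invertible I :=
  exists2 s, ~ Nil R s & prod_set I (residual s I) s.

Lemma den_invertible_principal s : ~ Nil R s -> den_invertible (principal s).
Proof.
move=> Ns; exists s => //; rewrite -[X in prod_set _ _ X]mulr1.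
by apply: prod_setM; [apply: principal_id | move=> a; rewrite mul1r].
Qed.

Local Notation psi := (to_image (phi_restr hR)).
Definition psiT : {rmorphism R -> total_quotient_ring (phiR hR)} :=
  to_total (phiR hR) \o psi.

Lemma to_image_surj (z : phiR hR) : exists b, z = psi b.
Proof.
by case: z => z vz; have [b _ e] := Defs.imageP _ _ vz; exists b; apply: val_inj.
Qed.

Lemma psi_eq a b : psi a = psi b <-> exists2 u, ~ Nil R u & u * a = u * b.
Proof.
split=> [/(congr1 val)/= | [u Nu e]].
  rewrite !phi_restrE => /loc_fracP[[u Nu] /=].
  by rewrite !mulr1; exists u => //; apply/(nonnilP hR).
apply: val_inj; rewrite /= !phi_restrE; apply/loc_fracP.
have Su : u \in nonnil hR by apply/nonnilP.
by exists (exist _ u Su); rewrite /= !mulr1.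
Qed.

Lemma psi_eq_Nil a b : psi a = psi b -> Nil R (a - b).
Proof.
move=> /psi_eq[u Nu e]; apply: (Nil_cancel Nu).
by rewrite mulrBr e subrr.
Qed.

Lemma psi_regular s : psi s \in regular (phiR hR) <-> ~ Nil R s.
Proof.
split=> [rs [n sn]|Ns].
  have : psi s ^+ n \in regular (phiR hR) by apply: rpredX.
  rewrite -rmorphXn sn rmorph0 => /regularP; apply; exists 1; last by rewrite mul0r.
  apply/eqP => e; have : Nil R (1 - 0).
    by apply: psi_eq_Nil; rewrite rmorph0 rmorph1.
  by rewrite subr0; case: hR => -[].
apply/regularP => -[y]; have [b ->] := to_image_surj y => /eqP b0 e; apply: b0.
have /psi_eq[u Nu] : psi (s * b) = psi 0 by rewrite rmorphM rmorph0.
rewrite mulr0 mulrA => e'; rewrite -(rmorph0 psi); apply/psi_eq.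
by exists (u * s); [apply: nonnilM | rewrite mulr0].
Qed.

(** An element of [phi(I)^-1] is a fraction [b / s], and [b I] is contained in
[sR] up to nilpotents, which are multiples of [s]: thus [b] lies in [(sR : I)].
Sums of products are then brought to a common denominator, since
[t (sR : I)] is contained in [(tsR : I)]. *)
Lemma clear_denominators I z :
    prod_set (to_total (phiR hR) @` phi_ideal I) (ideal_inv (phi_ideal I)) z ->
  exists s c, [/\ ~ Nil R s, prod_set I (residual s I) c & psiT s * z = psiT c].
Proof.
have N1 : ~ Nil R 1 by case: hR => -[].
move: z; apply: prod_set_ind => [|x y|_ y [_ [a Ia <-] <-]].
- by exists 1, 0; split; [| apply: prod_set0 | rewrite rmorph1 mul1r rmorph0].
- move=> [s [c [Ns Ic ec]]] [t [d [Nt Id ed]]].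
  exists (s * t), (t * c + s * d); split; first exact: nonnilM.
    apply: prod_setD.
      apply: prod_set_mulr Ic => b Rb; rewrite [s * t]mulrC.
      exact: residual_mul.
    by apply: prod_set_mulr Id => b Rb; apply: residual_mul.
  rewrite rmorphD !rmorphM -ec -ed; ring.
elim/loc_frac_ind: y => b0 [s0 rs0] iy.
have [b eb] := to_image_surj b0; have [s es] := to_image_surj s0.
subst b0 s0; have Ns : ~ Nil R s by apply/psi_regular.
have ey : psiT s * loc_frac (psi b) (exist _ (psi s) rs0) = psiT b.
  exact: (to_loc_mul_frac (psi b) (exist _ (psi s) rs0)).
exists s, (a * b); split=> //; last by rewrite mulrCA ey (rmorphM psiT).
apply: prod_setM => // a' Ia'.
have [r _ er] : range (to_total (phiR hR))
    (loc_frac (psi b) (exist _ (psi s) rs0) * psiT a').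
  by apply: iy; exists a'.
have [c ec] := to_image_surj r; subst r.
have : psi (b * a') = psi (s * c).
  apply: to_total_inj; rewrite -![to_total _ (psi _)]/(psiT _) !(rmorphM psiT).
  by rewrite -ey -mulrA -er.
by move=> /psi_eq_Nil; apply: eq_mod_Nil (nonnil_principal Ns) _; exists c.
Qed.

(** The map [R -> phi(R)] is onto with nil kernel and reflects regularity, so
an equation [1 = sum of the a_i (b_i / s)] in [T(phi(R))] amounts to
[s = sum of the a_i b_i] in [R] up to a nilpotent; that error is absorbed since
nilpotents lie in every nonnil ideal. *)
Lemma phi_invertibleP I : nonnil_ideal I -> phi_invertible hR I <-> den_invertible I.
Proof.
move=> nI; have [idI _] := nI; split.
  move=> inv; have : range (to_total (phiR hR)) 1 by exists 1; rewrite ?rmorph1.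
  rewrite -inv => /clear_denominators[s [c [Ns Ic]]].
  rewrite mulr1 => /to_total_inj/psi_eq_Nil Nsc; exists s => //.
  apply: eq_mod_Nil Ic Nsc; apply: nonnil_prod => //.
  by apply: nonnil_idealI (residual_ideal s I) _ Ns => a Ia; exists a.
move=> [s Ns Is]; rewrite /phi_invertible /invertible; apply/seteqP; split.
  apply: prod_set_ind => [|x y [a _ <-] [b _ <-]|_ y [a Ia <-] iy].
  - by exists 0; rewrite ?rmorph0.
  - by exists (a + b); rewrite ?rmorphD.
  by rewrite mulrC; apply: iy.
have rs : psi s \in regular (phiR hR) by apply/psi_regular.
pose v : total_quotient_ring (phiR hR) := loc_frac 1 (exist _ (psi s) rs).
have sv : psiT s * v = 1.
  exact: (to_loc_mul_frac 1 (exist _ (psi s) rs)).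
move=> _ [r0 _ <-]; have [r ->] := to_image_surj r0.
have -> : to_total (phiR hR) (psi r) = psiT (r * s) * v.
  by rewrite (rmorphM psiT) -mulrA sv mulr1.
have [_ _ /(_ r _ Is)] := prod_ideal I (residual_ideal s I).
move: (r * s); apply: prod_set_ind => [|x y Px Py|a b Ia Rb].
- by rewrite rmorph0 mul0r; apply: prod_set0.
- by rewrite rmorphD mulrDl; apply: prod_setD.
rewrite (rmorphM psiT) -mulrA; apply: prod_setM; first by exists (psi a) => //; exists a.
move=> _ [a' Ia' <-]; have [c ec] := Rb a' Ia'; exists (psi c) => //.
rewrite -[LHS]mul1r -sv -![to_total _ (psi _)]/(psiT _).
by rewrite mulrAC -!(rmorphM psiT) -ec !(rmorphM psiT) mulrAC.
Qed.

(** * Prüfer rings and distributivity *)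

Lemma prod_cap_sub I J K :
  prod_set (I `&` J) K `<=` prod_set I K `&` prod_set J K.
Proof. by move=> x Hx; split; apply: prod_setS Hx => // y []. Qed.

(** Multiplication by [b] sends [K] into [sR], hence [I K] into [s I]: the factor
[K] is traded for the common divisor [s]. *)
Lemma prod_residual I K s x b : is_ideal I ->
  prod_set I K x -> residual s K b -> exists2 w, I w & x * b = s * w.
Proof.
move=> [I0 ID IM] Hx Rb; move: x Hx.
apply: prod_set_ind => [|x y [w Iw ew] [w' Iw' ew']|i k Ii Kk].
- by exists 0; rewrite // mul0r mulr0.
- by exists (w + w'); [apply: ID | rewrite mulrDl ew ew' mulrDr].
have [c ec] := Rb k Kk; exists (c * i); first exact: IM.
by rewrite -mulrA [k * b]mulrC ec; ring.
Qed.

Lemma cap_mul_of_prufer : phi_prufer hR ->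
  forall I J K, nonnil_ideal I -> nonnil_ideal J -> nonnil_ideal K ->
  prod_set (I `&` J) K = prod_set I K `&` prod_set J K.
Proof.
move=> prufer I J K nI nJ nK; apply/seteqP; split; first exact: prod_cap_sub.
move=> x [IKx JKx]; have [idI _] := nI; have [idJ _] := nJ; have [idK _] := nK.
have nIJK : nonnil_ideal (prod_set (I `&` J) K) by apply/nonnil_prod/nK/nonnil_cap.
have [K1 [id1 fg1 s1 IK1x]] := prod_set_finite idK IKx.
have [K2 [id2 fg2 s2 JK2x]] := prod_set_finite idK JKx.
have [k Kk Nk] := nonnil_witness nK; have idk := principal_ideal k.
(* The principal summand makes K0 nonnil, even when x is 0. *)
pose K0 := add_set (principal k) (add_set K1 K2).
have id12 := add_ideal id1 id2; have id0 : is_ideal K0 by apply: add_ideal.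
have s10 : K1 `<=` K0.
  by move=> y K1y; apply: add_set_subr => //; apply: add_set_subl.
have s20 : K2 `<=` K0.
  by move=> y K2y; apply: add_set_subr => //; apply: add_set_subr.
have s0 : K0 `<=` K.
  apply: add_set_min => //; last exact: add_set_min.
  by move=> _ [c ->]; apply: ideal_mulr.
have n0 : nonnil_ideal K0.
  apply: nonnil_idealI id0 _ Nk.
  by apply: add_set_subl => //; apply: principal_id.
have fg0 : finitely_generated K0.
  apply: finitely_generated_add; first exact: finitely_generated_principal.
  exact: finitely_generated_add.
have [s Ns K0s] := (phi_invertibleP n0).1 (prufer K0 n0 fg0).
have IK0x : prod_set I K0 x by apply: prod_setS IK1x.
have JK0x : prod_set J K0 x by apply: prod_setS JK2x.
have clear_s : forall z, prod_set K0 (residual s K0) z ->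
    exists2 u, prod_set (I `&` J) K u & x * z = s * u.
  apply: prod_set_ind => [|y z [u Pu eu] [v Pv ev]|b c K0b Rc].
  - by exists 0; [apply: prod_set0 | rewrite !mulr0].
  - by exists (u + v); [apply: prod_setD | rewrite !mulrDr eu ev].
  have [w Iw ew] := prod_residual idI IK0x Rc.
  have [w' Jw' ew'] := prod_residual idJ JK0x Rc.
  have Jw : J w.
    apply: (eq_mod_Nil nJ Jw'); apply: (Nil_cancel Ns).
    by rewrite mulrBr -ew -ew' subrr.
  exists (w * b); first by apply: prod_setM; [| apply: s0].
  by rewrite mulrCA ew; ring.
have [u Pu eu] := clear_s s K0s.
apply: (eq_mod_Nil nIJK Pu); apply: (Nil_cancel Ns).
by rewrite mulrBr -eu mulrC subrr.
Qed.

Section Distributive.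
Hypothesis distr : forall I J K,
  nonnil_ideal I -> nonnil_ideal J -> nonnil_ideal K ->
  prod_set (I `&` J) K = prod_set I K `&` prod_set J K.

(** If [I I' = sR] and [J J' = tR] then [(I + J) (I `&` J) I' J' = IJ I'J' = stR]
by the inclusion of [IJ] in [(I `&` J) (I + J)]. *)
Lemma den_invertible_add I J : nonnil_ideal I -> nonnil_ideal J ->
  den_invertible I -> den_invertible J -> den_invertible (add_set I J).
Proof.
move=> nI nJ [s Ns Is] [t Nt Jt]; have [idI _] := nI; have [idJ _] := nJ.
have idIJ := add_ideal idI idJ.
have sIl := @add_set_subl _ I J idJ.
have sJr := @add_set_subr _ I J idI.
have nIJ : nonnil_ideal (add_set I J) by apply: nonnil_ideal_sup sIl.
exists (s * t); first exact: nonnilM.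
pose C := residual (s * t) (add_set I J).
have idC : is_ideal C by apply: residual_ideal.
have idP : is_ideal (prod_set (add_set I J) C) by apply: prod_ideal.
apply: (prod_set_mul_min idP) Is => i i' Ii Ri'.
rewrite mulrC; apply: (prod_set_mul_min idP) Jt => j j' Jj Rj'.
have -> : j * j' * (i * i') = (i * j) * (i' * j') by ring.
have capC w : (I `&` J) w -> C (w * (i' * j')).
  move=> [Iw Jw] _ [a [b [Ia Jb ->]]]; rewrite mulrDr.
  have [_ PD _] := principal_ideal (s * t); apply: PD.
    have [c ec] := Ri' a Ia; have [d ed] := Rj' w Jw; exists (c * d).
    have -> : w * (i' * j') * a = (i' * a) * (j' * w) by ring.
    by rewrite ec ed; ring.
  have [c ec] := Ri' w Iw; have [d ed] := Rj' b Jb; exists (c * d).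
  have -> : w * (i' * j') * b = (i' * w) * (j' * b) by ring.
  by rewrite ec ed; ring.
have : prod_set (I `&` J) (add_set I J) (i * j).
  rewrite distr //; split; first by apply: prod_setM => //; apply: sJr.
  by rewrite mulrC; apply: prod_setM => //; apply: sIl.
apply: (prod_set_mul_min idP) => w v /capC Cw IJv.
by rewrite mulrAC mulrC; apply: prod_setM.
Qed.

Lemma den_invertible_span n (g : 'I_n -> R) :
  nonnil_ideal (span g) -> den_invertible (span g).
Proof.
elim: n g => [g [_ []]|n IHn g].
  by apply: span_min => //; case.
rewrite span_recl; set P := principal _; set S := span _ => nPS.
have idP : is_ideal P by apply: principal_ideal.
have idS : is_ideal S by apply: span_ideal.
have [NP|nP] := pselect (P `<=` Nil R); have [NS|nS] := pselect (S `<=` Nil R).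
- by case: nPS => _ []; apply: add_set_min.
- suff -> : add_set P S = S by apply: IHn.
  apply/seteqP; split; last exact: add_set_subr.
  by apply: add_set_min => //; apply: subset_trans NP _; apply: Nil_sub.
all: have Pinv : den_invertible P by apply: den_invertible_principal => Ng;
  apply: nP => _ [c ->]; apply: ideal_mulr.
- suff -> : add_set P S = P by [].
  apply/seteqP; split; last exact: add_set_subl.
  by apply: add_set_min => //; apply: subset_trans NS _; apply: Nil_sub.
by apply: den_invertible_add => //; apply: IHn.
Qed.

Lemma prufer_of_cap_mul : phi_prufer hR.
Proof.
move=> I nI [n [g eI]]; apply/phi_invertibleP => //.
by move: nI; rewrite eI; apply: den_invertible_span.
Qed.

End Distributive.

End PhiRings.

Theorem theorem2p7 (R : comNzRingType) (hR : phi_ring R) :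
  phi_prufer hR <->
  (forall I J K : set R, nonnil_ideal I -> nonnil_ideal J -> nonnil_ideal K ->
     prod_set (I `&` J) K = prod_set I K `&` prod_set J K).
Proof. by split; [apply: cap_mul_of_prufer | apply: prufer_of_cap_mul]. Qed.
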